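(* The Dota Underlords problem without alliances (i.e. choose a team of at most $m$ of the $n$ heroes maximizing $\sum_{i=1}^n x_i s_i$) reduces to the maximum edge-weighted clique problem: there is an edge-weighted graph, of size bounded by a polynomial in the size of the Dota Underlords instance, such that an optimal solution of the Dota Underlords instance is obtained from a maximum edge-weighted clique of that graph.
   Context: Dota Underlords problem without alliances: given $n\in\mathbb{N}$ heroes with strengths $s_i\in\mathbb{R}$ and a maximum team size $m\in\mathbb{N}$, maximize $\sum_{i=1}^n x_is_i$ over $x_i\in\{0,1\}$ subject to $\sum_{i=1}^n x_i\le m$ (here $x_i=1$ iff hero $i$ is in the team). The maximum edge-weighted clique (MEWC) problem: given an undirected graph with real weights on its edges, find a clique maximizing the sum of the weights of the edges inside the clique. *)

(* Defs.v *)
From HB Require Import structures.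
From mathcomp Require Import all_boot all_order all_algebra.
From mathcomp Require Import reals.

Set Implicit Arguments.
Unset Strict Implicit.
Unset Printing Implicit Defensive.

Import Order.TTheory GRing.Theory Num.Theory.
Local Open Scope ring_scope.

Section Dota.
Variables (R : realType) (n m : nat) (s : 'I_n -> R).

Definition feasible_team (x : 'I_n -> bool) : Prop :=
  (\sum_(i < n) x i <= m)%N.

Definition team_strength (x : 'I_n -> bool) : R :=
  \sum_(i < n) (x i)%:R * s i.

Definition optimal_team (x : 'I_n -> bool) : Prop :=
  feasible_team x /\
  forall y, feasible_team y -> team_strength y <= team_strength x.

End Dota.

(* An instance consists of [n] real numbers, each of size 1, and of the
   integer [m], written in binary. *)
Definition dota_size (n m : nat) : nat := (n + (trunc_log 2 m).+1)%N.

(* The values of [weight] outside [edge] carry no information. *)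
Record wgraph (R : realType) := WGraph {
  nvertices : nat;
  edge : rel 'I_nvertices;
  weight : 'I_nvertices -> 'I_nvertices -> R;
  edge_irr : irreflexive edge;
  edge_sym : symmetric edge;
  weight_sym : forall u v, edge u v -> weight u v = weight v u
}.

Section Clique.
Variables (R : realType) (G : wgraph R).

Definition clique (K : {set 'I_(nvertices G)}) : Prop :=
  {in K &, forall u v, u != v -> edge u v}.

(* The condition [u < v] counts every undirected edge once. *)
Definition clique_weight (K : {set 'I_(nvertices G)}) : R :=
  \sum_(u in K) \sum_(v in K | (u < v)%N) weight u v.

Definition max_weight_clique (K : {set 'I_(nvertices G)}) : Prop :=
  clique K /\ forall L, clique L -> clique_weight L <= clique_weight K.

End Clique.

(* Since the data are real numbers, running time is measured on a real random
   access machine with unit costs. It has registers [idx x] holding natural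
   numbers and arrays [mem a] of real cells. Natural numbers can be added and
   subtracted (with truncation) but not multiplied, so that after [t] steps
   they have O(t) more bits than the initial ones; there is no conversion
   (rounding) from reals to naturals. *)
Record state (R : realType) := State {
  idx : nat -> nat;
  mem : nat -> nat -> R
}.

(* The cell [(a, x)] is the entry of the array [a] whose position is the
   current content of the register [x] (indirect addressing). *)
Definition cell : Type := (nat * nat)%type.

Variant arith := Add | Sub | Mul | Div.

Inductive prog :=
  | IConst of nat & nat
  | IAdd of nat & nat & nat
  | ISub of nat & nat & nat
  | RConst of cell & bool
  | ROp of arith & cell & cell & cell
  | Seq of prog & prog
  | IfI of nat & nat & prog & prog
  | IfR of cell & cell & prog & prog
  | While of nat & nat & prog.

Section Semantics.
Variable R : realType.
Implicit Types (st : state R) (c d e : cell).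

Definition iset st (x k : nat) : state R :=
  State (fun y => if y == x then k else idx st y) (mem st).

Definition rget st c : R := mem st c.1 (idx st c.2).

Definition rset st c (r : R) : state R :=
  State (idx st)
    (fun a k => if (a == c.1) && (k == idx st c.2) then r else mem st a k).

Definition arith_op (o : arith) (a b : R) : R :=
  match o with Add => a + b | Sub => a - b | Mul => a * b | Div => a / b end.

(* [exec P st t st'] : started in [st], the program [P] halts in [st'] after
   [t] steps; a step is an assignment or the evaluation of a test. *)
Inductive exec : prog -> state R -> nat -> state R -> Prop :=
  | ExecIConst st x k : exec (IConst x k) st 1 (iset st x k)
  | ExecIAdd st x y z :
      exec (IAdd x y z) st 1 (iset st x (idx st y + idx st z)%N)
  | ExecISub st x y z :
      exec (ISub x y z) st 1 (iset st x (idx st y - idx st z)%N)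
  | ExecRConst st c (b : bool) : exec (RConst c b) st 1 (rset st c b%:R)
  | ExecROp st o c d e :
      exec (ROp o c d e) st 1 (rset st c (arith_op o (rget st d) (rget st e)))
  | ExecSeq P Q st1 st2 st3 t u :
      exec P st1 t st2 -> exec Q st2 u st3 -> exec (Seq P Q) st1 (t + u) st3
  | ExecIfI x y P Q st st' t :
      exec (if (idx st x <= idx st y)%N then P else Q) st t st' ->
      exec (IfI x y P Q) st t.+1 st'
  | ExecIfR c d P Q st st' t :
      exec (if rget st c <= rget st d then P else Q) st t st' ->
      exec (IfR c d P Q) st t.+1 st'
  | ExecWhileStop x y P st :
      (idx st y <= idx st x)%N -> exec (While x y P) st 1 st
  | ExecWhileStep x y P st1 st2 st3 t u :
      (idx st1 x < idx st1 y)%N ->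
      exec P st1 t st2 -> exec (While x y P) st2 u st3 ->
      exec (While x y P) st1 (t + u).+1 st3.

(* Input [(n, m, s)]: [n] and [m] in the registers 0 and 1, and [s] in the
   array 0; everything else is 0. *)
Definition dota_input (n m : nat) (s : 'I_n -> R) : state R :=
  State (nth 0%N [:: n; m])
    (fun a k => if a == 0%N then oapp s 0 (insub k) else 0).

(* Output [G]: the number of vertices in the register 0, the adjacency and
   weight matrices, row by row, in the arrays 1 and 2. *)
Definition graph_output st (G : wgraph R) : Prop :=
  idx st 0 = nvertices G /\
  forall u v : 'I_(nvertices G),
    mem st 1 (u * nvertices G + v)%N = (edge u v)%:R /\
    (edge u v -> mem st 2 (u * nvertices G + v)%N = weight u v).

(* Input of the decoding: [n], [m] and the number of vertices in the registers
   0, 1 and 2, and the indicator vector of [K] in the array 0; everything else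
   is 0. The strengths of the heroes and the weights are not available. *)
Definition clique_input (n m N : nat) (K : {set 'I_N}) : state R :=
  State (nth 0%N [:: n; m; N])
    (fun a k => if a == 0%N then oapp (fun u => (u \in K)%:R) 0 (insub k)
                else 0).

(* Output [x]: the 0/1 vector [x] in the array 1. *)
Definition team_output (n : nat) st (x : 'I_n -> bool) : Prop :=
  forall i : 'I_n, mem st 1 i = (x i)%:R.

End Semantics.

(* Main.v *)
(* Let z be a dummy hero of strength 0. The vertices of the graph are the pairs
   (hero, slot) with n + 1 heroes and n + 1 slots, and two of them are adjacent
   when their heroes and their slots differ and both slots are at most m. So a
   clique is an assignment of distinct heroes to distinct slots among m + 1.
   The edges at z carry the strength of the other endpoint, and all other edges
   weigh 0: a clique containing z weighs the strength of its heroes, which form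
   a team of at most m heroes, and a clique without z weighs 0, like the empty
   team. Conversely every feasible team, together with z, fits in the slots. *)

Require Import Defs.
From mathcomp Require Import all_boot all_order all_algebra.
From mathcomp Require Import reals.
From mathcomp Require Import zify.

Import Order.TTheory GRing.Theory Num.Theory.
Local Open Scope ring_scope.

Set Implicit Arguments.
Unset Strict Implicit.
Unset Printing Implicit Defensive.

(* [ssrbool.mem] shadows the memory of a state. *)
Local Notation mem := Defs.mem.

(** * Timed execution of programs *)

Section Runs.
Variable R : realType.
Implicit Types (st : state R) (P : prog) (Q : state R -> Prop) (l : seq nat).

(** Total correctness with [T] as an upper bound on the time, so that branches of different lengths
    share one bound. *)
Definition runs P st (T : nat) Q : Prop :=
  exists t st', [/\ exec P st t st', (t <= T)%N & Q st'].

Lemma runs_weaken P st T T' Q Q' :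
  (T <= T')%N -> (forall st', Q st' -> Q' st') -> runs P st T Q ->
  runs P st T' Q'.
Proof.
move=> leT QQ' [t [st' [ex le_t Qst']]]; exists t, st'; split; auto.
exact: leq_trans leT.
Qed.

Lemma runs_iconst st x k Q : Q (iset st x k) -> runs (IConst x k) st 1 Q.
Proof. by move=> ?; exists 1%N, (iset st x k); split=> //; constructor. Qed.

Lemma runs_iadd st x y z Q :
  Q (iset st x (idx st y + idx st z)%N) -> runs (IAdd x y z) st 1 Q.
Proof. by move=> ?; exists 1%N; eexists; split; [constructor | | eassumption]. Qed.

Lemma runs_rconst st c (b : bool) Q : Q (rset st c b%:R) -> runs (RConst c b) st 1 Q.
Proof. by move=> ?; exists 1%N; eexists; split; [constructor | | eassumption]. Qed.

Lemma runs_rop st o c d e Q :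
  Q (rset st c (arith_op o (rget st d) (rget st e))) ->
  runs (ROp o c d e) st 1 Q.
Proof. by move=> ?; exists 1%N; eexists; split; [constructor | | eassumption]. Qed.

Lemma runs_seq P P' st T T' Q :
  runs P st T (fun st' => runs P' st' T' Q) -> runs (Seq P P') st (T + T')%N Q.
Proof.
move=> [t [st1 [ex1 le1 [u [st2 [ex2 le2 Q2]]]]]].
by exists (t + u)%N, st2; split=> //; [apply: ExecSeq ex1 ex2 | apply: leq_add].
Qed.

Lemma runs_step P P' st T Q :
  runs P st 1 (fun st' => runs P' st' T Q) -> runs (Seq P P') st T.+1 Q.
Proof. by rewrite -add1n; apply: runs_seq. Qed.

Lemma runs_last_step P P' st T Q :
  runs P st T (fun st' => runs P' st' 1 Q) -> runs (Seq P P') st T.+1 Q.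
Proof. by rewrite -(addn1 T); apply: runs_seq. Qed.

Lemma runs_ifI st x y P P' T Q :
  runs (if (idx st x <= idx st y)%N then P else P') st T Q ->
  runs (IfI x y P P') st T.+1 Q.
Proof. by move=> [t [st' [ex le_t Q']]]; exists t.+1, st'; split=> //; constructor. Qed.

(** The machine compares only by [<=], so equality takes two tests. *)
Definition IfEq x y P P' := IfI x y (IfI y x P P') P'.

Lemma runs_ifEq st x y P P' T Q :
  runs (if idx st x == idx st y then P else P') st T Q ->
  runs (IfEq x y P P') st T.+2 Q.
Proof.
move=> run; apply: runs_ifI; case: leqP => [le_xy|lt_yx].
  by apply: runs_ifI; move: run; rewrite eqn_leq le_xy.
by apply: (runs_weaken (leqnSn T) (fun _ h => h)); rewrite gtn_eqF in run.
Qed.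

Definition regs st l := forall x, (x < size l)%N -> idx st x = nth 0%N l x.

Lemma regs_iset st l x k :
  (x <= size l)%N -> regs st l -> regs (iset st x k) (set_nth 0%N l x k).
Proof.
move=> le_xl stl y; rewrite size_set_nth nth_set_nth /= => lt_y.
by case: eqP => // ne_yx; apply: stl; lia.
Qed.

Lemma regs_iset_rcons st l x k :
  size l = x -> regs st l -> regs (iset st x k) (rcons l k).
Proof.
move=> szl stl y; rewrite size_rcons nth_rcons /= szl => lt_y.
case: eqP => [->|ne_yx]; first by rewrite ltnn.
by have lt_yx : (y < x)%N; [lia | rewrite lt_yx; apply: stl; rewrite szl].
Qed.

Lemma regs_rcons st l k : regs st (rcons l k) -> regs st l.
Proof.
by move=> stl y lt_y; rewrite stl ?nth_rcons ?lt_y // size_rcons ltnS ltnW.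
Qed.

(* Register 3 holds the number of iterations, register 4 the constant 1. *)
Definition For x P := Seq (IConst x 0) (While x 3 (Seq P (IAdd x x 4))).

(* The registers below the loop counter [x] are described by [pre k] before
   the [k]-th iteration; those above [x] are scratch. *)
Lemma runs_for x P (T B : nat) (pre : nat -> seq nat)
    (M : nat -> (nat -> nat -> R) -> Prop) st :
  (4 < x)%N ->
  (forall k, [/\ size (pre k) = x, nth 0%N (pre k) 3 = B
               & nth 0%N (pre k) 4 = 1%N]) ->
  (forall k (st : state R), (k < B)%N -> regs st (rcons (pre k) k) -> M k (mem st) ->
    runs P st T
      (fun st' => regs st' (rcons (pre k.+1) k) /\ M k.+1 (mem st'))) ->
  regs st (pre 0%N) -> M 0%N (mem st) ->
  runs (For x P) st (B * (T + 2) + 2)%N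
    (fun st' => regs st' (pre B) /\ M B (mem st')).
Proof.
move=> lt4x preP stepP st0 M0.
have regB k st' : regs st' (rcons (pre k) k) ->
    [/\ idx st' x = k, idx st' 3 = B & idx st' 4 = 1%N].
  have [szk eq3 eq4] := preP k; move=> stk.
  rewrite !stk ?size_rcons ?szk; try lia.
  rewrite !nth_rcons szk ltnn eqxx eq3 eq4.
  by have -> : (3 < x)%N; [lia | rewrite lt4x].
(* Induction on the number [j] of iterations left. Each costs [T] plus the increment and the test;
   the initialization and the last test add 2. *)
suff loop j st' : (j <= B)%N -> regs st' (rcons (pre (B - j)%N) (B - j)%N) ->
    M (B - j)%N (mem st') ->
    runs (While x 3 (Seq P (IAdd x x 4))) st' (j * (T + 2) + 1)%N
      (fun st' => regs st' (pre B) /\ M B (mem st')).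
  rewrite addnC -[2%N]/(1 + 1)%N -addnA; apply: runs_seq; apply: runs_iconst.
  rewrite addnC; apply: loop; rewrite ?subnn //.
  by apply: regs_iset_rcons => //; case: (preP 0%N).
elim: j st' => [|j IHj] st' le_j stj Mj.
  move: stj Mj; rewrite subn0 => stB MB.
  have [eqx eq3 _] := regB _ _ stB.
  exists 1%N, st'; split=> //; first by apply: ExecWhileStop; rewrite eqx eq3.
  by split=> //; apply: regs_rcons stB.
have [eqx eq3 _] := regB _ _ stj.
have lt_k : (B - j.+1 < B)%N by lia.
have [t [st1 [ex1 le_t [st1k M1]]]] := stepP _ _ lt_k stj Mj.
have eqk : (B - j.+1).+1 = (B - j)%N by lia.
rewrite eqk in st1k M1.
have [szk _ eq4] := preP (B - j)%N.
have st1pre := regs_rcons st1k.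
have eq1x : idx st1 x = (B - j.+1)%N.
  by rewrite st1k ?size_rcons ?szk // nth_rcons szk ltnn eqxx.
have eq14 : idx st1 4 = 1%N by rewrite st1pre ?szk.
pose st2 := iset st1 x (idx st1 x + idx st1 4)%N.
have [||u [st3 [ex3 le_u Q3]]] := IHj st2 (ltnW le_j) => //.
  rewrite /st2 eq1x eq14 addn1 eqk.
  exact: regs_iset_rcons.
exists (t + 1 + u).+1, st3; split=> //; last by lia.
apply: ExecWhileStep ex3; first by rewrite eqx eq3.
by apply: ExecSeq ex1 _; constructor.
Qed.

End Runs.

(** * The slot graph *)

Section SlotGraph.
Variables (R : realType) (n m : nat) (s : 'I_n -> R).

(* The vertex [hero * n.+1 + slot] encodes a pair; [hero = n] is the dummy. *)
Definition hero (u : nat) := (u %/ n.+1)%N.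
Definition slot (u : nat) := (u %% n.+1)%N.

Definition compatible (u v : nat) : bool :=
  [&& hero u != hero v, slot u != slot v, (slot u <= m)%N & (slot v <= m)%N].

Definition strength (a : nat) : R := oapp s 0 (insub a).

(** The dummy has strength 0, so at its edges the sum is the strength of the other endpoint, in a
    symmetric form. *)
Definition link (u v : nat) : R :=
  if (n <= hero u)%N || (n <= hero v)%N then
    strength (hero u) + strength (hero v)
  else 0.

Let V := 'I_(n.+1 * n.+1).

Lemma compatible_irr : irreflexive (fun u v : V => compatible u v).
Proof. by move=> u; rewrite /compatible eqxx. Qed.

Lemma compatible_sym : symmetric (fun u v : V => compatible u v).
Proof.
move=> u v; rewrite /compatible [hero v == _]eq_sym [slot v == _]eq_sym.
by rewrite [(slot v <= m)%N && _]andbC.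
Qed.

Lemma link_sym (u v : V) : compatible u v -> link u v = link v u.
Proof. by rewrite /link orbC addrC. Qed.

(** There are [n + 1] slots and not [m + 1], because [m] is written in binary and may be exponential
    in the size of the instance. *)
Definition slot_graph : wgraph R :=
  WGraph compatible_irr compatible_sym link_sym.

Definition fielded (K : {set V}) (a : nat) : bool :=
  [exists u in K, hero u == a].

Definition team (K : {set V}) (i : 'I_n) : bool := fielded K n && fielded K i.

Lemma strength_dummy : strength n = 0.
Proof. by rewrite /strength insubF ?ltnn. Qed.

Lemma hero_le (u : V) : (hero u <= n)%N.
Proof. by rewrite -ltnS ltn_divLR. Qed.

(** * Cliques yield feasible teams of the same weight *)

Section OneClique.
Variable K : {set V}.
Hypothesis cliqueK : clique (G := slot_graph) K.

Lemma hero_inj : {in K &, forall u v : V, hero u = hero v -> u = v}.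
Proof.
move=> u v Ku Kv eqh; apply/eqP; apply/negPn/negP => ne_uv.
by have /and4P[/eqP] := cliqueK Ku Kv ne_uv.
Qed.

(** At most one term is left, by [hero_inj]. The semiring is [nat] when counting and [R] when
    weighing. *)
Lemma sum_fielded (S : pzSemiRingType) (a : nat) :
  \sum_(u in K | hero u == a) 1 = (fielded K a)%:R :> S.
Proof.
case: (boolP (fielded K a)) => [/existsP[u /andP[Ku /eqP hu]]|noK].
  rewrite (big_pred1 u) // => v /=.
  apply/andP/eqP => [[Kv /eqP hv]|->]; last by rewrite hu.
  by apply: hero_inj => //; rewrite hu hv.
by rewrite big_pred0 // => u; apply: contraNF noK => uP; apply/existsP; exists u.
Qed.

Lemma card_clique : (#|K| <= m.+1)%N.
Proof.
(* A lone vertex has no edge that would bound its slot by [m]. Two or more vertices occupy distinct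
   slots up to [m]. *)
case: (leqP #|K| 1) => [le1|gt1]; first exact: leq_trans le1 _.
have slotP (u : V) : u \in K -> (slot u <= m)%N.
  move=> Ku; move: gt1; rewrite (cardD1 u) Ku ltnS => /card_gt0P[v].
  rewrite !inE => /andP[ne_vu Kv].
  by have /and4P[] := cliqueK Kv Ku ne_vu.
rewrite -[m.+1]card_ord.
rewrite -(card_in_imset (f := fun u : V => inord (slot u) : 'I_m.+1)).
  exact: max_card.
move=> u v Ku Kv /(congr1 val); rewrite /= !inordK ?ltnS ?slotP // => eqs.
apply/eqP; apply/negPn/negP => ne_uv.
by have /and4P[_ /eqP] := cliqueK Ku Kv ne_uv.
Qed.

Lemma feasible_clique : feasible_team m (team K).
Proof.
rewrite /feasible_team /team; case: (boolP (fielded K n)) => [Kn|_] /=; last first.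
  by rewrite big1.
rewrite -ltnS; apply: leq_trans card_clique.
(* Count the vertices by hero; the dummy takes one of the at most [m + 1]. *)
have -> : #|K| = (\sum_(u in K) \sum_(a < n.+1 | hero u == a) 1)%N.
  rewrite -sum1_card; apply: eq_bigr => u _.
  rewrite (big_pred1 (inord (hero u))) // => a.
  by rewrite /= -val_eqE /= inordK ?ltnS ?hero_le // eq_sym.
rewrite (exchange_big_dep predT) //=.
have sumE a : (\sum_(u in K | hero u == a) 1)%N = fielded K a.
  by rewrite -[RHS]natn; apply: (sum_fielded nat).
under [leqRHS]eq_bigr => a _ do rewrite sumE.
by rewrite big_ord_recr /= Kn addn1.
Qed.

(** Without the dummy both sides vanish. With it, both become sums over the vertices [u] of [K] that
    agree term by term. *)
Lemma weight_clique :
  clique_weight (G := slot_graph) K = team_strength s (team K).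
Proof.
have gtn (u : V) : (n <= hero u)%N = (hero u == n).
  by rewrite eqn_leq hero_le.
rewrite /team_strength /team /clique_weight /=.
case: (boolP (fielded K n)) => [/existsP[z /andP[Kz /eqP hz]]|noz]; last first.
  rewrite big1 => [|u Ku]; last first.
    rewrite big1 // => v /andP[Kv _]; rewrite /link !gtn.
    case: ifP => // /orP[] hn; case/existsP: noz; [exists u | exists v].
      by rewrite Ku.
    by rewrite Kv.
  by rewrite big1 // => i _; rewrite mul0r.
under [RHS]eq_bigr => i _.
  rewrite -sum_fielded big_distrl /=.
  under eq_bigr => u _ do rewrite mul1r.
  over.
rewrite [RHS](exchange_big_dep (fun u => u \in K)) /= => [|? ? _ /andP[]//].
apply: eq_bigr => u Ku.
under [RHS]eq_bigl => i do rewrite Ku /=.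
have -> : \sum_(i < n | hero u == i) s i = strength (hero u).
  rewrite /strength; case: insubP => [i _ eqi|noi].
    by rewrite (big_pred1 i) // => j; rewrite /= -eqi eq_sym.
  by rewrite big1 // => i /eqP eqi; rewrite eqi ltn_ord in noi.
(* The hero is the leading digit, so the dummy's vertex [z] has the largest number in [K]: each
   [u != z] contributes only its edge to [z], and [z] contributes nothing. *)
have ltz (v : V) : v \in K -> v != z -> (v < z)%N && (hero v < n)%N.
  move=> Kv ne_vz; have hv : hero v != n.
    by apply: contraNneq ne_vz => hv; apply/eqP/hero_inj; rewrite ?hz.
  have lt_v : (hero v < n)%N by rewrite ltn_neqAle hv hero_le.
  rewrite lt_v andbT ltnNge; apply/negP => /(leq_div2r n.+1).
  by rewrite -/(hero v) -/(hero z) hz leqNgt lt_v.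
have [->|ne_uz] := eqVneq u z.
  rewrite hz strength_dummy big1 // => v /andP[Kv lt_zv].
  have /ltz := Kv; case: eqVneq lt_zv => [->|_]; first by rewrite ltnn.
  by move=> lt_zv /(_ isT) /andP[/(ltn_trans lt_zv)]; rewrite ltnn.
have /andP[lt_uz lt_hu] := ltz _ Ku ne_uz.
rewrite (bigD1 z) ?Kz //= big1 => [|v /andP[/andP[Kv _] ne_vz]].
  by rewrite addr0 /link hz leqnn orbT strength_dummy addr0.
have /andP[_ lt_hv] := ltz _ Kv ne_vz.
by rewrite /link leqNgt lt_hu leqNgt lt_hv.
Qed.

End OneClique.

(** * Feasible teams yield cliques *)

Section OneTeam.
Variable y : 'I_n -> bool.
Hypothesis feasible_y : feasible_team m y.

(** The default [true] puts the dummy on every team. *)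
Definition on_team (a : nat) : bool := oapp y true (insub a).
(* The members of the team take the slots in increasing order. *)
Definition rank (a : nat) : nat := \sum_(i < n | (i < a)%N) y i.

Definition team_clique : {set V} :=
  [set u : V | on_team (hero u) && (slot u == rank (hero u))].

(** The bound [n] makes the rank a slot, and the bound [m] makes that slot usable. *)
Lemma rank_le a : (rank a <= minn n m)%N.
Proof.
rewrite leq_min; apply/andP; split.
  rewrite -[leqRHS]muln1 -[X in (_ <= X * _)%N]card_ord -sum_nat_const /rank.
  by rewrite big_mkcond leq_sum // => i _; case: ifP => // _; case: (y i).
apply: leq_trans feasible_y; rewrite /rank big_mkcond leq_sum // => i _.
by case: ifP.
Qed.

(** Hero [a] counts for [rank b] but not for [rank a]. This keeps slots distinct; [b = n] covers the
    dummy. *)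
Lemma rank_lt a b :
  (a < b)%N -> (b <= n)%N -> on_team a -> (rank a < rank b)%N.
Proof.
move=> lt_ab le_bn; have lt_an := leq_trans lt_ab le_bn.
rewrite /on_team insubT /= => ya.
rewrite /rank [ltnRHS](bigD1 (Ordinal lt_an)) //= ya ltnS.
rewrite big_mkcond [leqRHS]big_mkcond leq_sum // => i _ /=.
case: ifP => // lt_ia; rewrite -val_eqE /= (ltn_trans lt_ia lt_ab).
by rewrite (ltn_eqF lt_ia).
Qed.

Lemma team_cliqueP : clique (G := slot_graph) team_clique.
Proof.
move=> u v; rewrite !inE => /andP[yu /eqP su] /andP[yv /eqP sv] ne_uv /=.
have ne_h : hero u != hero v.
  apply: contra_neq ne_uv => eqh; apply: val_inj => /=.
  rewrite (divn_eq u n.+1) (divn_eq v n.+1).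
  by rewrite -!/(hero _) -!/(slot _) su sv eqh.
have /andP[_ ru] : (rank (hero u) <= n)%N && (rank (hero u) <= m)%N.
  by rewrite -leq_min rank_le.
have /andP[_ rv] : (rank (hero v) <= n)%N && (rank (hero v) <= m)%N.
  by rewrite -leq_min rank_le.
rewrite /compatible ne_h su sv ru rv !andbT /=.
case: (ltngtP (hero u) (hero v)) ne_h => // lt_h _.
  by rewrite (ltn_eqF (rank_lt lt_h (hero_le v) yu)).
by rewrite (gtn_eqF (rank_lt lt_h (hero_le u) yv)).
Qed.

Lemma team_team_clique : team team_clique =1 y.
Proof.
have fieldedE a : (a <= n)%N -> fielded team_clique a = on_team a.
  move=> le_an; apply/existsP/idP => [[u /andP[]]|ya].
    by rewrite inE => /andP[yu _] /eqP <-.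
  have lt_r : (rank a < n.+1)%N.
    by rewrite ltnS; apply: leq_trans (rank_le a) (geq_minl _ _).
  have lt_u : (a * n.+1 + rank a < n.+1 * n.+1)%N by nia.
  exists (Ordinal lt_u); rewrite inE /hero /slot /= divnMDl // modnMDl.
  by rewrite divn_small // modn_small // addn0 ya !eqxx.
move=> i; rewrite /team !fieldedE ?leqnn ?(ltnW (ltn_ord i)) // /on_team.
rewrite insubF ?ltnn //=.
by rewrite valK.
Qed.

End OneTeam.

(** A feasible team is the team of its own clique, whose weight is at most that of [K]. *)
Lemma optimal_clique K :
  max_weight_clique (G := slot_graph) K -> optimal_team m s (team K).
Proof.
move=> [cliqueK maxK]; split=> [|y feas_y]; first exact: feasible_clique.
rewrite -weight_clique //.
apply: le_trans (maxK _ (team_cliqueP feas_y)).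
rewrite weight_clique; last exact: team_cliqueP.
rewrite /team_strength le_eqVlt; apply/orP; left; apply/eqP.
by apply: eq_bigr => i _; rewrite team_team_clique.
Qed.

End SlotGraph.

(** * The reduction *)

Section Reduction.
Variables (R : realType) (n m : nat) (s : 'I_n -> R).
Implicit Types (st : state R).

Local Notation N := (n.+1 * n.+1)%N.

Lemma hero_digit i j : (j < n.+1)%N -> hero n (i * n.+1 + j) = i.
Proof. by move=> lt_j; rewrite /hero divnMDl // divn_small // addn0. Qed.

Lemma slot_digit i j : (j < n.+1)%N -> slot n (i * n.+1 + j) = j.
Proof. by move=> lt_j; rewrite /slot modnMDl modn_small. Qed.

Lemma digit_lt i j : (i < n.+1)%N -> (j < n.+1)%N -> (i * n.+1 + j < N)%N.
Proof. by nia. Qed.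

(* Register 0 is the current row of the matrices, 5 the current position in
   them; 6 and 7 are the hero and the slot of the row, 8 and 9 those of the
   column. *)
Definition entry_edge : prog :=
  IfEq 6 8 (RConst (1, 5)%N false) (IfEq 7 9 (RConst (1, 5)%N false)
    (IfI 7 1 (IfI 9 1 (RConst (1, 5)%N true) (RConst (1, 5)%N false))
      (RConst (1, 5)%N false))).

(** Register 2 holds [n]. For the dummy, array 0 is read at position [n], where it is 0. *)
Definition entry_weight : prog :=
  IfI 2 6 (ROp Add (2, 5)%N (0, 6)%N (0, 8)%N)
    (IfI 2 8 (ROp Add (2, 5)%N (0, 6)%N (0, 8)%N) (RConst (2, 5)%N false)).

(** Looping over the digits of row and column avoids multiplication and division. Register 5,
    initially 0, serves to copy [n]; register 0 counts the rows and ends at the number of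
    vertices. *)
Definition reduction : prog :=
  Seq (IConst 4 1) (Seq (IAdd 2 0 5) (Seq (IAdd 3 0 4) (Seq (IConst 0 0)
    (For 6 (For 7 (Seq
      (For 8 (For 9 (Seq entry_edge (Seq entry_weight (IAdd 5 5 4)))))
      (IAdd 0 0 4))))))).

(** Loop invariant: the first [p] entries of both matrices are final, and array 0 is intact. *)
Definition filled (p : nat) (M : nat -> nat -> R) : Prop :=
  M 0%N =1 strength s /\
  forall u v, (u < N)%N -> (v < N)%N -> (u * N + v < p)%N ->
    M 1%N (u * N + v)%N = (compatible n m u v)%:R /\
    M 2 (u * N + v)%N = link s u v.

Definition entry_regs i j i' j' p :=
  [:: (i * n.+1 + j)%N; m; n; n.+1; 1%N; p; i; j; i'; j'].

Lemma runs_entry_edge i j i' j' p st :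
  (j < n.+1)%N -> (j' < n.+1)%N -> regs st (entry_regs i j i' j' p) ->
  runs entry_edge st 7 (eq (rset st (1, 5)%N
    (compatible n m (i * n.+1 + j) (i' * n.+1 + j'))%:R)).
Proof.
move=> lt_j lt_j' stE; rewrite /compatible !hero_digit // !slot_digit //.
apply: runs_ifEq; rewrite (stE 6) // (stE 8) //=.
case: eqP => _ /=.
  by apply: (runs_weaken _ (fun _ => id) (runs_rconst (Q := eq _) erefl)).
apply: runs_ifEq; rewrite (stE 7) // (stE 9) //=.
case: eqP => _ /=.
  by apply: (runs_weaken _ (fun _ => id) (runs_rconst (Q := eq _) erefl)).
apply: runs_ifI; rewrite (stE 7) // (stE 1%N) //=.
case: leqP => _ /=; last first.
  by apply: (runs_weaken _ (fun _ => id) (runs_rconst (Q := eq _) erefl)).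
apply: runs_ifI; rewrite (stE 9) // (stE 1%N) //=.
by case: leqP => _ /=; apply: (runs_rconst (Q := eq _)).
Qed.

Lemma runs_entry_weight i j i' j' p st :
  (j < n.+1)%N -> (j' < n.+1)%N -> regs st (entry_regs i j i' j' p) ->
  mem st 0%N =1 strength s ->
  runs entry_weight st 3 (eq (rset st (2, 5)%N
    (link s (i * n.+1 + j) (i' * n.+1 + j')))).
Proof.
move=> lt_j lt_j' stE st0; rewrite /link !hero_digit //.
have sumE : rget st (0, 6)%N + rget st (0, 8)%N = strength s i + strength s i'.
  by rewrite /rget /= (stE 6) // (stE 8) //= !st0.
apply: runs_ifI; rewrite (stE 2) // (stE 6) //=.
case: leqP => _ /=.
  by apply: (runs_weaken _ (fun _ => id) (runs_rop (Q := eq _) _)); rewrite //= sumE.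
apply: runs_ifI; rewrite (stE 2) // (stE 8) //=.
case: leqP => _ /=; last exact: (runs_rconst (Q := eq _)).
by apply: (runs_rop (Q := eq _)); rewrite /= sumE.
Qed.

Lemma runs_entry i j i' j' st (p := ((i * n.+1 + j) * N + (i' * n.+1 + j'))%N) :
  (i < n.+1)%N -> (j < n.+1)%N -> (i' < n.+1)%N -> (j' < n.+1)%N ->
  regs st (entry_regs i j i' j' p) -> filled p (mem st) ->
  runs (Seq entry_edge (Seq entry_weight (IAdd 5 5 4))) st 11
    (fun st' => regs st' (entry_regs i j i' j' p.+1) /\ filled p.+1 (mem st')).
Proof.
move=> lt_i lt_j lt_i' lt_j' stE [st0 st12].
have lt_u := digit_lt lt_i lt_j; have lt_v := digit_lt lt_i' lt_j'.
apply: (@runs_seq _ _ _ _ 7 4).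
apply: (runs_weaken _ _ (runs_entry_edge lt_j lt_j' stE)) => // _ <-.
set st1 := rset st _ _.
have st1E : regs st1 (entry_regs i j i' j' p) by [].
apply: (@runs_seq _ _ _ _ 3 1).
apply: (runs_weaken _ _ (runs_entry_weight lt_j lt_j' st1E st0)) => // _ <-.
apply: runs_iadd; split.
  rewrite /= (stE 5) // (stE 4) //= addn1.
  exact: (@regs_iset _ _ (entry_regs i j i' j' p) 5 p.+1).
split=> //= u v ltu ltv; rewrite ltnS leq_eqVlt (stE 5) //= => /predU1P[eqp|ltp].
  (* A position determines its row and column by division with remainder. *)
  have [-> ->] : u = (i * n.+1 + j)%N /\ v = (i' * n.+1 + j')%N.
    have N_gt0 : (0 < N)%N by [].
    have := congr1 (divn^~ N) eqp; have := congr1 (modn^~ N) eqp.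
    by rewrite /p !modnMDl !divnMDl // !modn_small // !divn_small // !addn0.
  by rewrite -/p eqxx.
by rewrite (ltn_eqF ltp); apply: st12.
Qed.

Definition reduction_time : nat :=
  (n.+1 * (n.+1 * (n.+1 * (n.+1 * 13 + 2 + 2) + 2 + 1 + 2) + 2 + 2) + 2).+4%N.

Lemma runs_reduction :
  runs reduction (dota_input m s) reduction_time
    (fun st => graph_output st (slot_graph m s)).
Proof.
rewrite /reduction /reduction_time.
apply: runs_step; apply: runs_iconst; apply: runs_step; apply: runs_iadd.
apply: runs_step; apply: runs_iadd; apply: runs_step; apply: runs_iconst.
rewrite /= ?addn0 ?addn1.
set st0 := iset _ _ _.
(* Registers before iteration [k] of each loop, from the outermost to the innermost; register 5 is
   the position reached. *)
pose pre1 k := [:: (k * n.+1)%N; m; n; n.+1; 1%N; (k * n.+1 * N)%N].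
pose pre2 i k := [:: (i * n.+1 + k)%N; m; n; n.+1; 1%N; ((i * n.+1 + k) * N)%N; i].
pose pre3 i j k :=
  [:: (i * n.+1 + j)%N; m; n; n.+1; 1%N; ((i * n.+1 + j) * N + k * n.+1)%N; i; j].
pose pre4 i j i' k :=
  [:: (i * n.+1 + j)%N; m; n; n.+1; 1%N;
      ((i * n.+1 + j) * N + (i' * n.+1 + k))%N; i; j; i'].
apply: (runs_weaken (leqnn _) _ (runs_for (pre := pre1)
  (M := fun k => filled (k * n.+1 * N)) _ _ _ _ _)) => //.
- move=> st1 [st1E [_ stF]]; split=> [|u v] /=; first exact: (st1E 0%N).
  have [|||-> ->] := stF u v => //.
  have := ltn_ord u; have := ltn_ord v; rewrite /=; nia.
- move=> i st1 lt_i st1E st1F.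
  apply: (runs_weaken (leqnn _) _ (runs_for (pre := pre2 i)
    (M := fun k => filled ((i * n.+1 + k) * N)) _ _ _ _ _)) => //.
  + by move=> st2; rewrite /pre2 [(i * _ + n.+1)%N]addnC -mulSn.
  + move=> j st2 lt_j st2E st2F.
    apply: runs_last_step.
    apply: (runs_weaken (leqnn _) _ (runs_for (pre := pre3 i j)
      (M := fun k => filled ((i * n.+1 + j) * N + k * n.+1)) _ _ _ _ _)) => //.
    * move=> st3; rewrite /pre3 [(_ * N + N)%N]addnC -mulSn -addnS => -[st3E st3F].
      apply: runs_iadd; rewrite (st3E 0%N) // (st3E 4) //= addn1 -addnS; split=> //.
      exact: (regs_iset _ st3E).
    * move=> i' st3 lt_i' st3E st3F.
      apply: (runs_weaken (leqnn _) _ (runs_for (T := 11) (pre := pre4 i j i')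
        (M := fun k => filled ((i * n.+1 + j) * N + (i' * n.+1 + k))) _ _ _ _ _)) => //.
      -- by move=> st4; rewrite /pre4 [(i' * _ + n.+1)%N]addnC -mulSn.
      -- move=> j' st4 lt_j' st4E st4F.
         rewrite /pre4 addnS addnS.
         exact: runs_entry.
      -- by rewrite /pre4 addn0.
      -- by rewrite addn0.
    * by rewrite /pre3 mul0n addn0.
    * by rewrite mul0n addn0.
  + by rewrite /pre2 addn0.
  + by rewrite addn0.
- by case=> [|[|[|[|[|[|]]]]]].
Qed.

End Reduction.

(** * The decoding *)

Section Decoding.
Variables (R : realType) (n m : nat) (s : 'I_n -> R).
Implicit Types (st : state R).

Local Notation N := (n.+1 * n.+1)%N.

Variable K : {set 'I_N}.
Hypothesis cliqueK : clique (G := slot_graph m s) K.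

Let selected (k : nat) : R := oapp (fun u => (u \in K)%:R) 0 (insub k).

(* Array 1 first receives the number of vertices of [K] in each hero's row, a
   0/1 value; multiplying by the entry of the dummy hero then yields the empty
   team when [K] does not contain the dummy hero. *)
Definition decoding : prog :=
  Seq (IConst 4 1) (Seq (IAdd 3 0 4) (Seq
    (For 6 (For 7 (Seq (ROp Add (1, 6)%N (1, 6)%N (0, 5)%N) (IAdd 5 5 4))))
    (For 6 (ROp Mul (1, 6)%N (1, 6)%N (1, 0)%N)))).

Let counted (p : nat) (M : nat -> nat -> R) : Prop :=
  M 0%N =1 selected /\
  forall a, M 1%N a = \sum_(0 <= c < p | hero n c == a) selected c.

(** A clique has at most one vertex per hero, so the counts are 0 or 1. *)
Lemma counted_fielded M a : counted N M -> M 1%N a = (fielded K a)%:R.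
Proof.
move=> [_ ->]; rewrite -(sum_fielded cliqueK) big_mkord big_mkcond.
rewrite [RHS]big_mkcond; apply: eq_bigr => u _; rewrite /selected valK /=.
by case: (u \in K); case: eqP.
Qed.

Let multiplied (k : nat) (M : nat -> nat -> R) : Prop :=
  forall a, M 1%N a = (fielded K a && ((a < k)%N ==> fielded K n))%:R.

Definition decoding_time : nat :=
  (n.+1 * (n.+1 * 4 + 2 + 2) + 2 + (n.+1 * 3 + 2)).+2.

Lemma runs_decoding :
  runs decoding (clique_input R n m K) decoding_time
    (fun st => team_output st (team K)).
Proof.
apply: runs_step; apply: runs_iconst; apply: runs_step; apply: runs_iadd.
rewrite /= addn1.
set st0 := iset _ _ _.
pose pre1 k := [:: n; m; N; n.+1; 1%N; (k * n.+1)%N].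
pose pre2 i k := [:: n; m; N; n.+1; 1%N; (i * n.+1 + k)%N; i].
apply: runs_seq.
apply: (runs_weaken (leqnn _) _ (runs_for (pre := pre1)
  (M := fun k => counted (k * n.+1)) _ _ _ _ _)) => //.
- move=> st1 [st1E st1C].
  apply: (runs_weaken (leqnn _) _ (runs_for (T := 1%N) (pre := fun=> pre1 n.+1)
    (M := multiplied) _ _ _ _ _)) => //.
  + move=> st2 [_ st2M] i; rewrite st2M /team andbC.
    by rewrite (ltn_trans (ltn_ord i)).
  + move=> k st2 lt_k st2E st2M; apply: runs_rop; split=> // a.
    rewrite /= /rget /= (st2E 6) // (st2E 0%N) //=.
    have [->|ne_ak] := eqVneq a k.
      (* As [k <= n], the dummy's entry is still unmodified when it is read, even for [k = n]. *)
      rewrite !st2M ltnn !ltnNge -ltnS lt_k /= !andbT leqnn /=.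
      by rewrite -natrM mulnb.
    by rewrite /= st2M ltnS [(a <= k)%N]leq_eqVlt (negPf ne_ak).
  + by move=> a; rewrite (counted_fielded _ st1C) andbT.
- move=> i st1 lt_i st1E st1C.
  apply: (runs_weaken (leqnn _) _ (runs_for (T := 2) (pre := pre2 i)
    (M := fun k => counted (i * n.+1 + k)) _ _ _ _ _)) => //.
  + by move=> st2; rewrite /pre2 [(i * _ + n.+1)%N]addnC -mulSn.
  + move=> j st2 lt_j st2E [st2s st2C].
    apply: runs_step; apply: runs_rop; apply: runs_iadd.
    rewrite /= (st2E 5) // (st2E 4) //= addn1 -addnS.
    split; first exact: (@regs_iset _ _ (rcons (pre2 i j) j) 5).
    split=> //= a; rewrite /rget /= (st2E 5) // (st2E 6) //= addnS.
    rewrite [RHS]big_mkcond big_nat_recr //= -big_mkcond hero_digit // -st2C.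
    by rewrite eq_sym st2s; case: eqP => [->|]; rewrite ?addr0.
  + by rewrite /pre2 addn0.
  + by rewrite addn0.
- by case=> [|[|[|[|[|[|]]]]]].
- by split=> //= a; rewrite big_geq.
Qed.

End Decoding.

Theorem theorem4 (R : realType) :
  exists (reduce decode : prog) (p : {poly nat}),
  forall (n m : nat) (s : 'I_n -> R),
  exists G : wgraph R,
    [/\ (nvertices G <= p.[dota_size n m])%N,
        exists (t : nat) (st : state R),
          [/\ exec reduce (dota_input m s) t st,
              (t <= p.[dota_size n m])%N
            & graph_output st G]
      & forall K : {set 'I_(nvertices G)}, max_weight_clique K ->
        exists (t : nat) (st : state R) (x : 'I_n -> bool),
          [/\ exec decode (clique_input R n m K) t st,
              (t <= p.[dota_size n m])%N,
              team_output st x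
            & optimal_team m s x]].
Proof.
(* Four nested loops of [n + 1] iterations give degree 4. As polynomials in [n + 1], the time bounds
   have coefficients summing to at most 32, so 40 suffices. *)
exists reduction, decoding, (40%N *: 'X^4) => n m s.
exists (slot_graph m s).
have [b1 b2 b3] : [/\ (n.+1 * n.+1 <= (40%N *: 'X^4).[dota_size n m])%N,
    (reduction_time n <= (40%N *: 'X^4).[dota_size n m])%N
  & (decoding_time n <= (40%N *: 'X^4).[dota_size n m])%N].
  rewrite hornerZ hornerXn.
  have le_size : (n.+1 ^ 4 <= dota_size n m ^ 4)%N.
    by rewrite leq_exp2r // /dota_size addnS ltnS leq_addr.
  suff [? ? ?] : [/\ (n.+1 * n.+1 <= 40 * n.+1 ^ 4)%N,
      (reduction_time n <= 40 * n.+1 ^ 4)%N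
    & (decoding_time n <= 40 * n.+1 ^ 4)%N].
    by split; apply: leq_trans (leq_mul (leqnn 40) le_size).
  rewrite /reduction_time /decoding_time !expnS expn0 muln1.
  have : (0 < n.+1)%N by [].
  by move: n.+1 => q q0; split; nia.
split=> //.
  have [t [st [ex le_t out]]] := runs_reduction m s.
  by exists t, st; split=> //; apply: leq_trans b2.
move=> K maxK; have [cliqueK _] := maxK.
have [t [st [ex le_t out]]] := runs_decoding cliqueK.
exists t, st, (team K); split=> //; first exact: leq_trans b3.
exact: optimal_clique maxK.
Qed.
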